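(* Let $n\geq 2$, let $a_1,a_2,\dots,a_n$ be positive integers with $\gcd(a_1,a_2,\dots,a_n)=1$, and let $b$ be a non-negative integer. Let $M$ be the least common multiple of $a_1,\dots,a_n$ and let $r$ be the remainder of $b$ modulo $M$. If $$\left[\frac{b}{M}\right]\geq \left[n-\frac{\sum_{i=1}^{n}a_i+r}{M}\right],$$ then the equation $\sum_{i=1}^{n}a_ix_i=b$ is solvable in non-negative integers $x_1,\dots,x_n$.
   Context: $[x]$ denotes the largest integer not exceeding the real number $x$. The remainder $r$ of $b$ modulo $M$ satisfies $0\le r<M$ and $b\equiv r \pmod M$. *)

(* Defs.v *)
From mathcomp Require Export all_boot all_order all_algebra.
Set Implicit Arguments.
Unset Strict Implicit.
Unset Printing Implicit Defensive.

(* Main.v *)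
Require Import Defs.
From mathcomp Require Import all_boot all_order all_algebra.
From mathcomp Require Import zify ring.

(** Since [a i] divides [M], replacing [x i] by its remainder modulo
    [M / a i] changes [\sum_i a i * x i] by a multiple of [M] only.  As the
    [a i] are globally coprime, Bezout therefore provides a tuple of small
    entries, [x i <= M / a i - 1], with [\sum_i a i * x i] congruent to [b]
    modulo [M] ([small_combination]).  This sum is at most [n * M - \sum_i a i].

    On the other hand, because [b = (b %/ M) * M + r], the hypothesis on the
    integer parts says precisely that [n * M < b + M + \sum_i a i]
    ([floor_hypothesis_bound]).  Hence the small sum is less than [b + M]; being
    congruent to [b] modulo [M], it is at most [b], and the difference is a
    nonnegative multiple of [M], which any single [a j] can absorb
    ([combination_of_large]). *)

Local Open Scope nat_scope.

(** Bezout's identity modulo [m], where the coefficients can be kept in [nat]: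
    a coefficient [-1] is replaced by [m - 1].  The values reached form a set
    closed under linear combinations, hence under [gcdn]. *)
Lemma bezout_modn (I : finType) (a : I -> nat) (m : nat) : 0 < m ->
  exists x : I -> nat, \sum_i a i * x i = \big[gcdn/0]_i a i %[mod m].
Proof.
move=> m_gt0.
pose reached g := exists x : I -> nat, \sum_i a i * x i = g %[mod m].
have reached_comb c d g h :
    reached g -> reached h -> reached (c * g + d * h).
  move=> [x gx] [y hy]; exists (fun i => c * x i + d * y i).
  have -> : \sum_i a i * (c * x i + d * y i)
          = c * (\sum_i a i * x i) + d * (\sum_i a i * y i).
    rewrite !big_distrr /= -big_split /=.
    by apply: eq_bigr => i _; ring.
  by rewrite -modnDm -modnMmr gx -(modnMmr d) hy !modnMmr modnDm.
apply: (big_ind reached) => [|g h Rg Rh|j _].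
- by exists (fun=> 0); rewrite big1 // => i _; rewrite muln0.
- have [->|g_gt0] := posnP g; first by rewrite gcd0n.
  case: (egcdnP h g_gt0) => u v uv _.
  have [x Hx] := reached_comb u (m.-1 * v) _ _ Rg Rh.
  exists x; rewrite Hx uv.
  have -> : v * h + gcdn g h + m.-1 * v * h = v * h * m + gcdn g h.
    by rewrite -{2}(prednK m_gt0); ring.
  by rewrite modnMDl.
- exists (fun i => i == j : nat).
  rewrite (bigD1 j) //= eqxx muln1 big1 ?addn0 // => i /negPf->.
  by rewrite muln0.
Qed.

(** The bound [a i * x i + a i <= M] is [x i <= M / a i - 1] without division. *)
Lemma small_combination (I : finType) (a : I -> nat) (M b : nat) :
    0 < M -> (forall i, a i %| M) -> \big[gcdn/0]_i a i = 1 ->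
  exists2 x : I -> nat,
    \sum_i a i * x i = b %[mod M] & forall i, a i * x i + a i <= M.
Proof.
move=> M_gt0 dvd_aM gcd1.
have [x] := bezout_modn I a M M_gt0; rewrite gcd1 => Hx.
exists (fun i => (b * x i) %% (M %/ a i)) => [|i].
  have reduce i : a i * ((b * x i) %% (M %/ a i)) = (b * (a i * x i)) %% M.
    by rewrite muln_modr [X in _ %% X]mulnC divnK // mulnCA.
  under eq_bigr => i _ do rewrite reduce.
  by rewrite modn_summ -big_distrr /= -modnMmr Hx modnMmr muln1.
have a_gt0 : 0 < a i := dvdn_gt0 M_gt0 (dvd_aM i).
have quot_gt0 : 0 < M %/ a i by rewrite divn_gt0 // dvdn_leq.
by rewrite -mulnSr mulnC -leq_divRL // ltn_mod.
Qed.

(** The multiple of [M] left over by a small combination goes to index [j]. *)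
Lemma combination_of_large (I : finType) (a : I -> nat) (M b : nat) (j : I) :
    0 < M -> (forall i, a i %| M) -> \big[gcdn/0]_i a i = 1 ->
    #|I| * M < b + M + \sum_i a i ->
  exists x : I -> nat, \sum_i a i * x i = b.
Proof.
move=> M_gt0 dvd_aM gcd1 large_b.
have [x congr_x small_x] := small_combination I a M b M_gt0 dvd_aM gcd1.
set T := \sum_i a i * x i in congr_x.
have T_lt : T < b + M.
  have : T + \sum_i a i <= #|I| * M.
    by rewrite -big_split -sum_nat_const; apply: leq_sum => i _; apply: small_x.
  by lia.
have T_le : T <= b.
  rewrite leqNgt; apply/negP => b_lt.
  have : M %| T - b by rewrite -eqn_mod_dvd ?(ltnW b_lt) // congr_x.
  by move/dvdn_leq; rewrite subn_gt0 b_lt => /(_ isT); lia.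
have dvd_diff : M %| b - T by rewrite -eqn_mod_dvd // congr_x.
exists (fun i => x i + (i == j) * ((b - T) %/ a j)).
under eq_bigr => i _ do rewrite mulnDr.
rewrite big_split /= -/T (bigD1 j) //= eqxx mul1n big1 => [|i /negPf->].
  by rewrite addn0 mulnC divnK ?subnKC // (dvdn_trans (dvd_aM j)).
by rewrite mul0n muln0.
Qed.

Section Floor.
Import Order.TTheory GRing.Theory Num.Theory.
Local Open Scope ring_scope.

(** An inequality between the integer parts of [y] and [z] means that [y] is
    less than the integer part of [z] plus one, here [b %/ M + 1].  Once
    multiplied by [M], the term [b %% M] of [y] completes [(b %/ M) * M] to [b]. *)
Lemma floor_hypothesis_bound (n M S b : nat) : (0 < M)%N ->
    Num.floor (n%:R - (S + b %% M)%N%:R / M%:R : rat)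
      <= Num.floor (b%:R / M%:R : rat) ->
  (n * M < b + M + S)%N.
Proof.
move=> M_gt0 le_floor.
have M_gt0' : 0 < M%:R :> rat by rewrite ltr0n.
have floor_b : Num.floor (b%:R / M%:R : rat) = (b %/ M)%N.
  apply/eqP; rewrite floor_eq; apply/andP; split.
    by rewrite ler_pdivlMr // -pmulrn -natrM ler_nat leq_divM.
  rewrite ltr_pdivrMr // -PoszD -pmulrn -natrM ltr_nat addn1.
  by rewrite ltn_ceil.
move: le_floor; rewrite floor_b -ltzD1 floor_lt_int.
rewrite -PoszD -pmulrn ltrBlDr -(ltr_pM2r M_gt0').
rewrite mulrDl divfK ?gt_eqF // -!natrM -natrD ltr_nat => bound.
by rewrite {1}(divn_eq b M); lia.
Qed.

End Floor.

Local Open Scope ring_scope.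

Theorem theorem2p1 (n : nat) (hn : (2 <= n)%N)
    (a : 'I_n -> nat) (ha : forall i : 'I_n, (0 < a i)%N)
    (hgcd : \big[gcdn/0%N]_(i < n) a i = 1%N) (b : nat) :
  let M : nat := \big[lcmn/1%N]_(i < n) a i in
  let r : nat := (b %% M)%N in
  Num.floor (n%:R - ((\sum_(i < n) a i) + r)%N%:R / M%:R : rat)
    <= Num.floor (b%:R / M%:R : rat) ->
  exists x : 'I_n -> nat, (\sum_(i < n) a i * x i)%N = b.
Proof.
move=> M r le_floor.
have M_gt0 : (0 < M)%N.
  by apply: (big_ind (fun m => 0 < m)%N) => // u v; rewrite lcmn_gt0 => -> ->.
have dvd_aM i : (a i %| M)%N by rewrite /M (bigD1 i) //= dvdn_lcml.
apply: (combination_of_large _ _ M _ (Ordinal (ltnW hn))) => //.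
by rewrite card_ord; apply: floor_hypothesis_bound.
Qed.
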